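(* Let $(V,\omega)$ be an $n$-dimensional multisymplectic vector space of degree $k+1$ and let $W$ be a linear subspace of $V$. Below, $l,l',l''$ denote integers in $\{1,\ldots,n\}$. (1) If $W$ is Type-II $l$-isotropic, then $W$ is Type-II $l'$-isotropic for all $l'\geq l$. (2) If $W$ is Type-II $l$-coisotropic, then $W$ is Type-II $l''$-coisotropic for all $l''\leq l$. (3) $W$ is Type-II $l$-isotropic for all $l\geq\dim W$. (4) Every subspace of $V$ containing a Type-II $l$-coisotropic subspace is Type-II $l$-coisotropic. (5) Every subspace of $V$ that is contained in a Type-II $l$-isotropic subspace is Type-II $l$-isotropic.
   Context: Vector spaces are real. A multisymplectic vector space of degree $k+1$ (with $k\ge 1$) is a pair $(V,\omega)$ with $V$ an $n$-dimensional vector space and $\omega$ an exterior $(k+1)$-form on $V$ such that $v\lrcorner\omega=0$ iff $v=0$, for $v\in V$. Contraction: $(v_1\wedge\cdots\wedge v_r)\lrcorner\omega=\omega(v_1,\ldots,v_r,\cdot,\ldots,\cdot)$, a form of degree $k+1-r$, understood to be $0$ if $r>k+1$. For a subspace $W\subseteq V$, $G^lW=\{w_1\wedge\cdots\wedge w_l:w_i\in W\}$ is the set of decomposable $l$-multivectors (it always contains $0$). The Type-II $l$-th orthogonal complement of $W$, $1\le l\le n$, is $W_{II}^{\perp,l}=\{v_1\wedge\cdots\wedge v_l\in G^lV:(v_1\wedge\cdots\wedge v_l\wedge w)\lrcorner\omega=0\text{ for all }w\in W\}$. $W$ is Type-II $l$-isotropic if $G^lW\subseteq W_{II}^{\perp,l}$,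 and Type-II $l$-coisotropic if $W_{II}^{\perp,l}\subseteq G^lW$. *)

(* Defs.v *)
From HB Require Import structures.
From mathcomp Require Import all_boot all_order all_algebra.
From mathcomp Require Import boolp classical_sets functions reals.

Set Implicit Arguments.
Unset Strict Implicit.
Unset Printing Implicit Defensive.
Import GRing.Theory.
Local Open Scope ring_scope.
Local Open Scope classical_set_scope.

(* Families (v_1, ..., v_m) of vectors are functions on 'I_m. *)
Section Families.
Variable T : Type.

Definition upd m (v : 'I_m -> T) (i : 'I_m) (x : T) : 'I_m -> T :=
  fun j => if j == i then x else v j.

Definition fcat r s (v : 'I_r -> T) (u : 'I_s -> T) : 'I_(r + s) -> T :=
  fun i => match fintype.split i with inl j => v j | inr j => u j end.

Lemma fcat_lshift r s (v : 'I_r -> T) (u : 'I_s -> T) i :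
  fcat v u (lshift s i) = v i.
Proof. by rewrite /fcat -[lshift s i]/(unsplit (inl i)) unsplitK. Qed.

Lemma fcat_rshift r s (v : 'I_r -> T) (u : 'I_s -> T) i :
  fcat v u (rshift r i) = u i.
Proof. by rewrite /fcat -[rshift r i]/(unsplit (inr i)) unsplitK. Qed.

Lemma fcat_updl r s (v : 'I_r -> T) (u : 'I_s -> T) i x :
  fcat (upd v i x) u = upd (fcat v u) (lshift s i) x.
Proof.
apply/funext => j; rewrite -[j]fintype.splitK /upd.
by case: (fintype.split j) => k /=; rewrite ?fcat_lshift ?fcat_rshift
  ?(inj_eq (@lshift_inj _ _)) ?eq_rlshift.
Qed.

Lemma fcat_updr r s (v : 'I_r -> T) (u : 'I_s -> T) i x :
  fcat v (upd u i x) = upd (fcat v u) (rshift r i) x.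
Proof.
apply/funext => j; rewrite -[j]fintype.splitK /upd.
by case: (fintype.split j) => k /=; rewrite ?fcat_lshift ?fcat_rshift
  ?(inj_eq (@rshift_inj _ _)) ?eq_lrshift.
Qed.

End Families.

Section ExteriorForms.
Variables (R : realType) (V : vectType R).

Definition multilinear m (f : ('I_m -> V) -> R^o) : Prop :=
  forall (i : 'I_m) (v : 'I_m -> V), linear (fun x : V => f (upd v i x)).

Definition alternating m (f : ('I_m -> V) -> R^o) : Prop :=
  forall (i j : 'I_m) (v : 'I_m -> V), i != j -> v i = v j -> f v = 0.

Definition is_exform m : {pred ('I_m -> V) -> R^o} :=
  [pred f | `[< multilinear f /\ alternating f >]].

Lemma is_exformP m (f : ('I_m -> V) -> R^o) :
  reflect (multilinear f /\ alternating f) (f \in @is_exform m).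
Proof. exact: asboolP. Qed.

Fact is_exform_submod m : submod_closed (@is_exform m).
Proof.
split.
  by apply/is_exformP; split=> // i v a x y /=; rewrite /GRing.zero /= scaler0 addr0.
move=> a f g /is_exformP[fl fa] /is_exformP[gl ga]; apply/is_exformP; split.
  move=> i v b x y /=.
  have fgE u : (a *: f + g) u = a * f u + g u by [].
  by rewrite !fgE fl gl /GRing.scale /= !mulrDr !mulrA [a * b]mulrC addrACA.
move=> i j v ij vij; have -> : (a *: f + g) v = a * f v + g v by [].
by rewrite (fa i j) // (ga i j) // mulr0 addr0.
Qed.

HB.instance Definition _ m :=
  GRing.isSubmodClosed.Build R (('I_m -> V) -> R^o) (@is_exform m)
    (@is_exform_submod m).

(* The space Alt^m(V) of exterior m-forms on V. *)
Record exform m := ExForm {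
  exform_fun :> ('I_m -> V) -> R^o;
  exform_mem : exform_fun \in @is_exform m }.

HB.instance Definition _ m := [isSub for @exform_fun m].
HB.instance Definition _ m := [Choice of exform m by <:].
HB.instance Definition _ m := [SubChoice_isSubLmodule of exform m by <:].

Lemma exform_eq m (f g : exform m) : f =1 g -> f = g.
Proof. by move=> fg; apply/val_inj/funext. Qed.

Lemma exformDE m (f g : exform m) v : (f + g) v = f v + g v.
Proof. by []. Qed.

Lemma exformZE m a (f : exform m) v : (a *: f) v = a * f v.
Proof. by []. Qed.

(* The exterior power of degree r of V. As V is finite-dimensional it is
   canonically the dual space of Alt^r(V), the multivector v_1 /\ ... /\ v_r
   being the functional alpha |-> alpha(v_1, ..., v_r). *)
Definition multivector r := {scalar exform r}.

Section Decomposable.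
Variables (r : nat) (v : 'I_r -> V).
Definition wedge_fun (alpha : exform r) : R := alpha v.
Fact wedge_fun_scalar : scalar wedge_fun.
Proof. by move=> a f g; rewrite /wedge_fun exformDE exformZE. Qed.
HB.instance Definition _ :=
  GRing.isLinear.Build R (exform r) R _ wedge_fun wedge_fun_scalar.
Definition wedge : multivector r := wedge_fun.
End Decomposable.

Lemma wedgeE r (v : 'I_r -> V) (alpha : exform r) : wedge v alpha = alpha v.
Proof. by []. Qed.

Lemma multivector_eq r (X Y : multivector r) : X =1 Y -> X = Y.
Proof.
move=> XY; case: X Y XY => [X cX] [Y cY] /= /funext XY.
rewrite {}XY in cX *; congr GRing.Linear.Pack.
case: cX cY => [[a1] [b1]] [[a2] [b2]].
by rewrite (Prop_irrelevance a1 a2) (Prop_irrelevance b1 b2).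
Qed.

Section Contraction.
Variables r s : nat.

Fact headform_subproof (omega : exform (r + s)) (u : 'I_s -> V) :
  (fun v : 'I_r -> V => omega (fcat v u)) \in @is_exform r.
Proof.
have /is_exformP[oml oma] := exform_mem omega.
apply/is_exformP; split.
  move=> i v a x y /=; rewrite !fcat_updl; exact: oml.
move=> i j v ij vij; apply: (oma (lshift s i) (lshift s j)).
  by rewrite (inj_eq (@lshift_inj _ _)).
by rewrite !fcat_lshift.
Qed.

(* omega(., ..., ., u_1, ..., u_s) *)
Definition headform (omega : exform (r + s)) (u : 'I_s -> V) : exform r :=
  ExForm (headform_subproof omega u).

Fact contr_subproof (X : multivector r) (omega : exform (r + s)) :
  (fun u : 'I_s -> V => X (headform omega u)) \in @is_exform s.
Proof.
have /is_exformP[oml oma] := exform_mem omega.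
apply/is_exformP; split.
  move=> i u a x y /=; rewrite -[RHS](linearP X); congr (X _).
  apply: exform_eq => v; rewrite exformDE exformZE /= !fcat_updr; exact: oml.
move=> i j u ij uij; rewrite -[RHS](linear0 X); congr (X _).
apply: exform_eq => v; apply: (oma (rshift r i) (rshift r j)).
  by rewrite (inj_eq (@rshift_inj _ _)).
by rewrite !fcat_rshift.
Qed.

(* The contraction X _| omega, defined so as to be linear in X; on decomposable
   multivectors it is the formula of contr_wedge. *)
Definition contr (X : multivector r) (omega : exform (r + s)) : exform s :=
  ExForm (contr_subproof X omega).

Lemma contr_wedge (v : 'I_r -> V) (omega : exform (r + s)) (u : 'I_s -> V) :
  contr (wedge v) omega u = omega (fcat v u).
Proof. by []. Qed.

Section Product.
Variables (X : multivector r) (Y : multivector s).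
Definition wedge_prod_fun (alpha : exform (r + s)) : R := Y (contr X alpha).
Fact wedge_prod_fun_scalar : scalar wedge_prod_fun.
Proof.
move=> a f g; rewrite /wedge_prod_fun -[RHS](linearP Y); congr (Y _).
apply: exform_eq => u; rewrite exformDE exformZE /= -[RHS](linearP X).
by congr (X _); apply: exform_eq.
Qed.
HB.instance Definition _ :=
  GRing.isLinear.Build R (exform (r + s)) R _ wedge_prod_fun
    wedge_prod_fun_scalar.
(* X /\ Y *)
Definition wedge_prod : multivector (r + s) := wedge_prod_fun.
End Product.

Lemma wedge_prod_wedge (v : 'I_r -> V) (u : 'I_s -> V) :
  wedge_prod (wedge v) (wedge u) = wedge (fcat v u).
Proof. exact: multivector_eq. Qed.

End Contraction.

Definition cast_exform m m' (e : m = m') (omega : exform m) : exform m' :=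
  ecast i (exform i) e omega.

Lemma cast_exformE m m' (e : m = m') (omega : exform m) (v : 'I_m' -> V) :
  cast_exform e omega v = omega (fun i => v (cast_ord e i)).
Proof.
case: m' / e v => v /=.
by congr (omega _); apply/funext => i; rewrite cast_ord_id.
Qed.

(* X _| omega, with the convention that it is 0 when r > m. *)
Definition contraction r m (X : multivector r) (omega : exform m) :
    exform (m - r) :=
  match decP (@idP (r <= m)%N) with
  | left h => contr X (cast_exform (esym (subnKC h)) omega)
  | right _ => 0
  end.

Lemma contraction_wedge r m (h : (r <= m)%N) (v : 'I_r -> V)
    (omega : exform m) (u : 'I_(m - r) -> V) :
  contraction (wedge v) omega u =
  omega (fun i => fcat v u (cast_ord (esym (subnKC h)) i)).
Proof.
rewrite /contraction; case: decP => [h'|/(_ h)//].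
by rewrite contr_wedge cast_exformE (bool_irrelevance h h').
Qed.

Lemma contraction_gt r m (X : multivector r) (omega : exform m) :
  (m < r)%N -> contraction X omega = 0.
Proof.
by rewrite /contraction => lt_mr; case: decP => // le_rm; rewrite ltnNge le_rm in lt_mr.
Qed.

Definition vec (v : V) : multivector 1 := wedge (fun=> v).

Definition multisymplectic k (omega : exform k.+1) : Prop :=
  (1 <= k)%N /\ forall v : V, contraction (vec v) omega = 0 <-> v = 0.

(* The set G^l W of decomposable l-multivectors of W. *)
Definition decomposable (l : nat) (W : {vspace V}) : set (multivector l) :=
  [set X | exists2 w : 'I_l -> V, (forall i, w i \in W) & X = wedge w].
Arguments decomposable : clear implicits.

Definition orthoII m (omega : exform m) (l : nat) (W : {vspace V}) :
    set (multivector l) :=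
  [set X | decomposable l fullv X /\
    forall w, w \in W -> contraction (wedge_prod X (vec w)) omega = 0].
Arguments orthoII {m} omega l W _.

Definition isotropicII m (omega : exform m) (l : nat) (W : {vspace V}) : Prop :=
  decomposable l W `<=` orthoII omega l W.

Definition coisotropicII m (omega : exform m) (l : nat) (W : {vspace V}) :
    Prop :=
  orthoII omega l W `<=` decomposable l W.

End ExteriorForms.
Arguments decomposable {R V} l W _.
Arguments orthoII {R V m} omega l W _.

(* Main.v *)
Require Import Defs.
From HB Require Import structures.
From mathcomp Require Import all_boot all_order all_algebra.
From mathcomp Require Import perm reals boolp classical_sets.

Set Implicit Arguments.
Unset Strict Implicit.
Unset Printing Implicit Defensive.
Import GRing.Theory.
Local Open Scope ring_scope.

(** On a decomposable multivector, the condition defining the Type-II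
    complement says that omega vanishes on every list of arguments that starts
    with v_1, ..., v_l, w; when l > k no such list fits into the k + 1 slots and
    the condition is void.  So W is l-isotropic iff omega vanishes as soon as
    its first l + 1 arguments lie in W ([isotropicIIP]).  This condition gets
    weaker when l grows, and it is automatic when l >= dim W, because l + 1
    vectors of W are then linearly dependent and alternating forms vanish on
    dependent families ([form_not_free]).

    Monotonicity in the subspace is formal: G^l W grows with W and the
    complement shrinks.

    For coisotropy, one goes down one degree at a time
    ([coisotropicII_pred]).  The zero multivector is in G^l W, as 0 /\ ... /\ 0.
    Let v_1 /\ ... /\ v_l be nonzero and orthogonal to W, with 0 < l < dim V,
    and choose x outside the span of the v_i.  Then
    v_1 /\ ... /\ v_l /\ x is again orthogonal to W, by moving x past the
    argument w at the cost of a sign ([form_tperm]).  By coisotropy in degree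
    l + 1 it is a decomposable multivector of W.  A nonzero decomposable
    multivector determines the span of its factors
    ([free_wedge_decomposable]), so all v_i lie in W.  *)

Section TypeIIComplements.
Variables (R : realType) (V : vectType R).

(** * Alternating forms on dependent and permuted families *)

Lemma upd_same (T : Type) m (x : 'I_m -> T) i : upd x i (x i) = x.
Proof. by apply/funext => j; rewrite /upd; case: eqP => [->|]. Qed.

(** Expanding the sum by linearity, every term but the i-th repeats one of the
    other arguments.  *)
Lemma form_upd_sum m (f : exform V m) (x : 'I_m -> V) i (c : 'I_m -> R) :
  f (upd x i (\sum_j c j *: x j)) = c i * f x.
Proof.
have /is_exformP[fl fa] := exform_mem f.
pose L : {linear V -> R^o} := HB.pack (fun y : V => f (upd x i y) : R^o)
  (GRing.isLinear.Build R V R^o _ _ (fl i x)).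
have -> : f (upd x i (\sum_j c j *: x j)) = \sum_j c j * f (upd x i (x j)).
  rewrite -[LHS]/(L _) linear_sum.
  by apply: eq_bigr => j _; apply: (linearZ_LR L).
rewrite (bigD1 i) //= upd_same big1 ?addr0 // => j ji.
by rewrite (fa i j) ?mulr0 // 1?eq_sym // /upd eqxx (negPf ji).
Qed.

Lemma form_not_free m (f : exform V m) (x : 'I_m -> V) :
  ~~ free [tuple x i | i < m] -> f x = 0.
Proof.
apply: contraNeq => fx0; apply/freeP => c c0 i.
have cx0 : \sum_j c j *: x j = 0.
  by rewrite -[RHS]c0; apply: eq_bigr => j _; rewrite -tnth_nth tnth_mktuple.
(* Replacing the i-th argument by the zero sum \sum_j c_j x_j multiplies
   f x by c_i; with zero coefficients it gives 0. *)
have /= := form_upd_sum f x i (fun=> 0).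
rewrite [X in upd x i X]big1 => [|j _]; last by rewrite scale0r.
rewrite -cx0 form_upd_sum mul0r => /eqP.
by rewrite mulf_eq0 (negPf fx0) orbF => /eqP.
Qed.

Lemma form_tperm m (f : exform V m) (x : 'I_m -> V) i j :
  i != j -> f (fun p => x (tperm i j p)) = - f x.
Proof.
move=> ij; have /is_exformP[fl fa] := exform_mem f.
(* The two slots i and j carry a biadditive h with h y y = 0, which is
   antisymmetric by polarization. *)
pose h y z := f (upd (upd x i y) j z).
have updC y z : upd (upd x i y) j z = upd (upd x j z) i y.
  apply/funext => p; rewrite /upd.
  by case: (p =P j) => [->|//]; rewrite eq_sym (negPf ij).
have hDr y z1 z2 : h y (z1 + z2) = h y z1 + h y z2.
  by have := fl j (upd x i y) 1 z1 z2; rewrite !scale1r.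
have hDl y1 y2 z : h (y1 + y2) z = h y1 z + h y2 z.
  by rewrite /h !updC; have := fl i (upd x j z) 1 y1 y2; rewrite !scale1r.
have h0 y : h y y = 0.
  by apply: (fa i j) => //; rewrite /upd eqxx (negPf ij) eqxx.
have /eqP := h0 (x i + x j).
rewrite hDr !hDl !h0 add0r addr0 addr_eq0.
have -> : h (x i) (x j) = f x by rewrite /h upd_same upd_same.
have -> : h (x j) (x i) = f (fun p => x (tperm i j p)).
  congr (f _); apply/funext => p; rewrite /upd.
  by case: tpermP => [->|->|/eqP/negPf-> /eqP/negPf->//];
    rewrite ?eqxx ?(negPf ij).
by move/eqP.
Qed.

(** * Decomposable multivectors and the span of their factors *)

Definition det_fun m (phi : 'I_m -> {scalar V}) (x : 'I_m -> V) : R^o :=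
  \det (\matrix_(b, a) phi a (x b)).

Lemma det_fun_exform m (phi : 'I_m -> {scalar V}) :
  det_fun phi \in @is_exform R V m.
Proof.
apply/is_exformP; split=> [i x c y z | i j x ij xij].
  rewrite /det_fun -[X in _ = _ + X]mul1r.
  apply: (determinant_multilinear (i0 := i)).
  - by apply/rowP => a; rewrite !mxE /upd eqxx linearP mul1r.
  - by apply/matrixP => b a; rewrite !mxE /upd eq_sym (negPf (neq_lift i b)).
  - by apply/matrixP => b a; rewrite !mxE /upd eq_sym (negPf (neq_lift i b)).
by apply: (determinant_alternate ij) => a; rewrite !mxE xij.
Qed.

Definition det_form m (phi : 'I_m -> {scalar V}) : exform V m :=
  ExForm (det_fun_exform phi).

Lemma separating_functional (W : {vspace V}) v :
  v \notin W -> exists2 psi : {scalar V}, psi v != 0 & {in W, psi =1 (fun=> 0)}.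
Proof.
move=> vW; pose u := v - projv W v.
have u0 : u != 0.
  by apply: contraNneq vW => /eqP; rewrite subr_eq0 => /eqP->; apply: memv_proj.
have [j uj] : exists j, coord (vbasis {:V}) j u != 0.
  apply/existsP; apply: contraNT u0 => /existsPn uj.
  rewrite (coord_vbasis (memvf u)) big1 // => j _.
  by have /negPn/eqP-> := uj j; rewrite scale0r.
have psil : scalar (fun x => coord (vbasis {:V}) j (x - projv W x)).
  by move=> a x y; rewrite linearP -[RHS]linearP scalerBr addrACA opprD.
pose psi : {scalar V} :=
  HB.pack (fun x : V => coord (vbasis {:V}) j (x - projv W x) : R)
  (GRing.isLinear.Build R V R _ _ psil).
exists psi => //= x xW.
by rewrite projv_id // subrr linear0.
Qed.

(** If v_i were outside W, some functional psi would vanish on W but not at v_i.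
    Replacing the i-th functional of a dual basis of v by psi gives functionals
    whose determinant form is nonzero on v, as it equals psi (v_i) there, but
    vanishes on families of W because of its i-th column.  *)
Lemma free_wedge_decomposable l (W : {vspace V}) (v : 'I_l -> V) :
  free [tuple v i | i < l] -> decomposable l W (wedge v) -> forall i, v i \in W.
Proof.
move=> vfree [w wW vw] i.
apply: contraT => /separating_functional[psi psiv psiW].
pose phi a : {scalar V} := if a == i then psi else coord [tuple v i | i < l] a.
have : det_form phi v = det_form phi w by rewrite -!wedgeE vw.
rewrite [RHS](expand_det_col _ i) big1 => [|b _]; last first.
  by rewrite !mxE /phi eqxx psiW ?mul0r.
move/eqP; apply: contraLR => _; rewrite -unitfE -unitmxE -row_free_unit.
have phiv a b : a != i -> phi a (v b) = (b == a)%:R.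
  move=> /negPf ai; rewrite /phi ai.
  have -> : v b = [tuple v i | i < l]`_b by rewrite -tnth_nth tnth_mktuple.
  exact: coord_free.
(* The matrix is the identity outside column i: a vector in its left kernel
   has only an i-th entry, which psi (v_i) != 0 then kills. *)
apply: inj_row_free => u /rowP uA.
have ua a : a != i -> u 0 a = 0.
  move=> ai; have := uA a; rewrite !mxE (bigD1 a) //= mxE phiv // eqxx mulr1.
  by rewrite big1 ?addr0 // => b /negPf ba; rewrite mxE phiv // ba mulr0.
apply/rowP => a; rewrite mxE; have [->|/ua//] := eqVneq a i.
have := uA i; rewrite !mxE (bigD1 i) //= mxE /phi eqxx big1 => [|b /ua->].
  by rewrite addr0 => /eqP; rewrite mulf_eq0 (negPf psiv) orbF => /eqP.
by rewrite mul0r.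
Qed.

(** * Orthogonality and isotropy as vanishing conditions *)

(** Argument lists of omega are taken as restrictions of sequences
    g : nat -> V, so that prefixes of different lengths can be compared without
    casts between ordinal types.  *)
Lemma contraction_wedge_eq0 r m (omega : exform V m) (v : 'I_r -> V) :
  contraction (wedge v) omega = 0 <->
  ((r <= m)%N -> forall g : nat -> V, (forall i : 'I_r, g i = v i) ->
     omega (fun i => g i) = 0).
Proof.
split=> [c0 rm g gv | H].
  have : contraction (wedge v) omega (fun j => g (r + j)%N) = 0 by rewrite c0.
  rewrite (contraction_wedge rm) => <-; congr (omega _); apply/funext => i.
  rewrite /fcat; case: fintype.splitP => j /= -> //.
have [rm|mr] := leqP r m; last exact: contraction_gt.
apply: exform_eq => u; rewrite (contraction_wedge rm).
pose x i := fcat v u (cast_ord (esym (subnKC rm)) i).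
pose g p := oapp x 0 (insub p).
have gx (i : 'I_m) : g i = x i by rewrite /g valK.
rewrite -/x (_ : x = fun i : 'I_m => g i); last by apply/funext => i; rewrite gx.
apply: (H rm) => i; rewrite (gx (widen_ord rm i)) /x -(fcat_lshift v u).
by congr (fcat _ _ _); apply: val_inj.
Qed.

Lemma contraction_wedge_vec_eq0 l k (omega : exform V k.+1)
    (v : 'I_l -> V) (w : V) :
  contraction (wedge_prod (wedge v) (vec w)) omega = 0 <->
  ((l <= k)%N -> forall g : nat -> V, (forall i : 'I_l, g i = v i) -> g l = w ->
     omega (fun i => g i) = 0).
Proof.
have lE : (l + 1 <= k.+1)%N = (l <= k)%N by rewrite addn1.
rewrite wedge_prod_wedge contraction_wedge_eq0 lE.
split=> H lk g gv => [gw|]; apply: H => //.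
- move=> i; rewrite /fcat; case: fintype.splitP => j ->; first exact: gv.
  by rewrite ord1 addn0.
- by move=> i; rewrite (gv (lshift 1 i)) fcat_lshift.
- by have := gv (rshift l ord0); rewrite fcat_rshift /= addn0.
Qed.

Lemma decomposableS l (U U' : {vspace V}) :
  (U <= U')%VS -> (decomposable l U `<=` decomposable l U')%classic.
Proof. by move=> /subvP UU' _ [w wU ->]; exists w => // i; apply: UU'. Qed.

Lemma orthoIIS m (omega : exform V m) l (U U' : {vspace V}) :
  (U <= U')%VS -> (orthoII omega l U' `<=` orthoII omega l U)%classic.
Proof. by move=> /subvP UU' X [dX X0]; split=> // w /UU'; apply: X0. Qed.

(** The vectors g_0, ..., g_(l-1) are the factors of the multivector and g_l is
    the vector w it is tested against: both range over W, so the condition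
    treats them alike.  *)
Lemma isotropicIIP l k (omega : exform V k.+1) (W : {vspace V}) :
  isotropicII omega l W <->
  ((l <= k)%N -> forall g : nat -> V, (forall i, (i <= l)%N -> g i \in W) ->
     omega (fun i => g i) = 0).
Proof.
split=> [iso lk g gW | H _ [w wW ->]].
  have [|_ /(_ (g l) (gW l (leqnn l)))] := iso (wedge (fun i : 'I_l => g i)).
    by exists (fun i : 'I_l => g i) => // i; apply/gW/ltnW.
  by move/contraction_wedge_vec_eq0; apply.
split; first by exists w => // i; rewrite memvf.
move=> y yW; apply/contraction_wedge_vec_eq0 => lk g gw gl; apply: H => // i.
rewrite leq_eqVlt => /predU1P[->|il]; first by rewrite gl.
by rewrite (gw (Ordinal il)).
Qed.

Lemma isotropicII_leq k (omega : exform V k.+1) (W : {vspace V}) l l' :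
  (l <= l')%N -> isotropicII omega l W -> isotropicII omega l' W.
Proof.
move=> ll' /isotropicIIP iso; apply/isotropicIIP => lk g gW.
by apply: iso => [|i il]; [apply: leq_trans lk | apply/gW/(leq_trans il)].
Qed.

Lemma isotropicII_dim k (omega : exform V k.+1) (W : {vspace V}) l :
  (\dim W <= l)%N -> isotropicII omega l W.
Proof.
move=> dWl; apply/isotropicIIP => lk g gW; apply: form_not_free.
have -> : [tuple g i | i < k.+1] = mkseq g k.+1 :> seq V.
  by rewrite /= /mkseq -val_enum_ord -map_comp.
rewrite -(cat_take_drop l.+1 (mkseq g k.+1)); apply/negP => /catl_free.
rewrite /free -map_take take_iota (minn_idPl _) // size_map size_iota => /eqP dg.
suff : (l.+1 <= \dim W)%N by rewrite ltnNge dWl.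
rewrite -dg; apply/dimvS/span_subvP => _ /mapP[i il ->].
by apply: gW; rewrite mem_iota in il.
Qed.

(** * Coisotropy in lower degrees *)

(** The bound on l + 1 leaves room for a vector x outside the span of the
    factors; wedging with it lifts the multivector to degree l + 1.  *)
Lemma coisotropicII_pred k (omega : exform V k.+1) (W : {vspace V}) l :
  (l + 1 <= \dim {:V})%N ->
  coisotropicII omega (l + 1) W -> coisotropicII omega l W.
Proof.
move=> ln cois _ [[v _ ->] vW].
have [vfree|vdep] := boolP (free [tuple v i | i < l]); last first.
  have l0 : (0 < l)%N.
    rewrite lt0n; apply: contraNneq vdep => l0.
    have /size0nil-> : size [tuple v i | i < l] = 0%N by rewrite size_tuple.
    exact: nil_free.
  (* Here v_1 /\ ... /\ v_l = 0 = 0 /\ ... /\ 0. *)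
  exists (fun=> 0) => [i|]; first exact: mem0v.
  apply: multivector_eq => f; rewrite !wedgeE (form_not_free _ vdep).
  rewrite (form_not_free f) //; apply: contraTN (eqxx (0 : V)) => free0.
  apply: (free_not0 free0); apply/tnthP.
  by exists (Ordinal l0); rewrite tnth_mktuple.
have [x xv] : exists x, x \notin <<[tuple v i | i < l]>>%VS.
  apply: contrapT => /forallNP allin.
  have : ({:V} <= <<[tuple v i | i < l]>>)%VS.
    by apply/subvP => x _; have /negP/negPn := allin x.
  move/dimvS; apply/negP; rewrite -ltnNge.
  by rewrite (leq_ltn_trans (dim_span _)) // size_tuple -addn1.
pose vx := fcat v (fun _ : 'I_1 => x).
have vxfree : free [tuple vx i | i < l + 1].
  have -> : [tuple vx i | i < l + 1] = rcons [tuple v i | i < l] x :> seq V.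
    apply: (@eq_from_nth _ 0) => [|i].
      by rewrite size_rcons !size_tuple addn1.
    rewrite size_tuple => il; rewrite -[i]/(val (Ordinal il)) -tnth_nth.
    rewrite tnth_mktuple nth_rcons size_tuple /vx /fcat.
    case: fintype.splitP => j /= ->; last by rewrite ord1 addn0 eqxx.
    by rewrite -[RHS]/([tuple v i | i < l]`_j) -tnth_nth tnth_mktuple.
  have /perm_free-> : perm_eq (rcons [tuple v i | i < l] x)
    (x :: [tuple v i | i < l]) by rewrite perm_rcons.
  by rewrite free_cons xv.
exists v => // i; rewrite -(fcat_lshift v (fun _ : 'I_1 => x)).
apply: (free_wedge_decomposable vxfree); apply: cois; split.
  by exists vx => // j; rewrite memvf.
move=> w wW; apply/contraction_wedge_vec_eq0 => lk g gvx gw.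
rewrite addn1 in lk gw.
(* The arguments are v_1, ..., v_l, x, w; exchange the last two. *)
have ll : (l < k.+1)%N by apply: ltnW.
have ll1 : (l.+1 < k.+1)%N by [].
have ne : Ordinal ll != Ordinal ll1 :> 'I_k.+1.
  by rewrite -val_eqE /= neq_ltn ltnSn.
apply/eqP; rewrite -oppr_eq0 -(form_tperm _ _ ne); apply/eqP.
pose s p := if p == l then l.+1 else if p == l.+1 then l else p.
rewrite (_ : (fun p => _) = (fun p : 'I_k.+1 => g (s p))).
  have /contraction_wedge_vec_eq0 H := vW w wW.
  apply: (H _ (fun p => g (s p))); first exact: ltnW.
  - move=> j; have jl := ltn_ord j.
    rewrite /s (ltn_eqF jl) (ltn_eqF (leqW jl)).
    by rewrite (gvx (lshift 1 j)) /vx fcat_lshift.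
  - by rewrite /s eqxx.
apply/funext => p; congr g; rewrite /s.
case: tpermP => [->|->|/eqP pl /eqP pl1] /=.
- by rewrite eqxx.
- by rewrite eqxx gtn_eqF.
- by rewrite -!val_eqE /= in pl pl1; rewrite (negPf pl) (negPf pl1).
Qed.

Lemma coisotropicII_geq k (omega : exform V k.+1) (W : {vspace V}) l l' :
  (l' <= l <= \dim {:V})%N ->
  coisotropicII omega l W -> coisotropicII omega l' W.
Proof.
move=> /andP[/subnKC <-].
elim: (l - l')%N => [|d IHd]; first by rewrite addn0.
rewrite addnS -addn1 => dn /(coisotropicII_pred dn); apply: IHd.
by apply: leq_trans dn; rewrite leq_addr.
Qed.

End TypeIIComplements.

Local Close Scope ring_scope.

Theorem proposition3p3 (R : realType) (V : vectType R) (n k : nat)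
    (omega : exform V k.+1) (W : {vspace V}) :
  \dim {:V} = n -> multisymplectic omega ->
  (forall l l', 1 <= l <= n -> 1 <= l' <= n -> isotropicII omega l W ->
     l <= l' -> isotropicII omega l' W) /\
  (forall l l'', 1 <= l <= n -> 1 <= l'' <= n -> coisotropicII omega l W ->
     l'' <= l -> coisotropicII omega l'' W) /\
  (forall l, 1 <= l <= n -> \dim W <= l -> isotropicII omega l W) /\
  (forall l (U U' : {vspace V}), 1 <= l <= n -> coisotropicII omega l U ->
     (U <= U')%VS -> coisotropicII omega l U') /\
  (forall l (U U' : {vspace V}), 1 <= l <= n -> isotropicII omega l U ->
     (U' <= U)%VS -> isotropicII omega l U').
Proof.
move=> dimV _; split; [|split; [|split; [|split]]].
- by move=> l l' _ _ iso ll'; apply: isotropicII_leq iso.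
- move=> l l'' /andP[_ ln] _ cois l''l.
  by apply: coisotropicII_geq cois; rewrite ?dimV ?l''l.
- by move=> l _; apply: isotropicII_dim.
- move=> l U U' _ cois UU' X /(orthoIIS UU') /cois; exact: decomposableS.
- move=> l U U' _ iso UU' X /(decomposableS UU') /iso; exact: orthoIIS.
Qed.
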